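(* Let $n\ge 2$ and let $P=(p_1,\dots,p_n)$, $Q=(q_1,\dots,q_n)$ be probability distributions with all $p_i>0$, $q_i>0$ and $\sum_i p_i=\sum_i q_i=1$. With the differences $D_{\Psi B}=D_{\Psi B}(P\|Q)$ defined in the context, $$D_{\Psi K_0}\le D_{\Psi T}\le D_{\Psi J}\le D_{\Psi M_3}\le D_{\Psi h}\le D_{\Psi M_2}\le D_{\Psi M_1}\le D_{\Psi I}\le D_{\Psi\Delta}$$ and $$D_{\Psi\Delta}\le \tfrac65 D_{\Psi I}\le \tfrac{16}{13}D_{\Psi M_1}\le \tfrac{48}{37}D_{\Psi M_2}\le \tfrac43 D_{\Psi h},$$ $$\tfrac43 D_{\Psi h}\le \tfrac32 D_{\Psi J}\le 2D_{\Psi K_0},\qquad \tfrac43 D_{\Psi h}\le \tfrac{16}{11}D_{\Psi M_3}\le 2D_{\Psi K_0},$$ $$2D_{\Psi K_0}\le 2D_{\Psi T}.$$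
   Context: For $P,Q$ as in the claim define (all sums over $i=1,\dots,n$): $\Delta=\sum \frac{(p_i-q_i)^2}{p_i+q_i}$; $I=\frac12\left[\sum p_i\ln\frac{2p_i}{p_i+q_i}+\sum q_i\ln\frac{2q_i}{p_i+q_i}\right]$; $M_1=\sum\left[\sqrt{\frac{p_i+q_i}{2}}\,\frac{\sqrt{p_i}+\sqrt{q_i}}{2}-\left(\frac{\sqrt{p_i}+\sqrt{q_i}}{2}\right)^2\right]$; $M_2=\sum\left[\frac{\sqrt{p_i}+\sqrt{q_i}}{2}\sqrt{\frac{p_i+q_i}{2}}-\sqrt{p_iq_i}\right]$; $h=\frac12\sum(\sqrt{p_i}-\sqrt{q_i})^2$; $M_3=\sum\left[\frac{p_i+q_i}{2}-\frac{\sqrt{p_i}+\sqrt{q_i}}{2}\sqrt{\frac{p_i+q_i}{2}}\right]$; $J=\sum(p_i-q_i)\ln\frac{p_i}{q_i}$; $T=\sum\frac{p_i+q_i}{2}\ln\frac{p_i+q_i}{2\sqrt{p_iq_i}}$; $K_0=\sum\frac{(p_i-q_i)^2}{\sqrt{p_iq_i}}$; $\Psi=\sum\frac{(p_i-q_i)^2(p_i+q_i)}{p_iq_i}$. Associate to these symbols the normalized quantities $\bar\Delta=\frac14\Delta$, $\bar I=I$, $\bar M_1=4M_1$, $\bar M_2=\frac43M_2$, $\bar h=h$, $\bar M_3=4M_3$, $\bar J=\frac18J$, $\bar T=T$, $\bar K_0=\frac18K_0$, $\bar\Psi=\frac1{16}\Psi$. For two symbols $A,B$ put $D_{AB}=D_{AB}(P\|Q):=\bar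 A-\bar B$; e.g. $D_{\Psi I}=\frac1{16}\Psi-I$, $D_{\Psi K_0}=\frac1{16}\Psi-\frac18K_0$. *)

(* Defs.v *)
From mathcomp Require Import all_boot all_order all_algebra.
From mathcomp Require Import all_classical all_reals all_analysis.
Set Implicit Arguments.
Unset Strict Implicit.
Unset Printing Implicit Defensive.
Import Order.TTheory GRing.Theory Num.Theory.
Local Open Scope ring_scope.

Section Divergences.
Variables (R : realType) (n : nat).
Implicit Types p q : 'I_n -> R.

Definition divDelta p q : R := \sum_(i < n) (p i - q i) ^+ 2 / (p i + q i).

Definition divI p q : R :=
  2^-1 * (\sum_(i < n) p i * ln (2 * p i / (p i + q i))
          + \sum_(i < n) q i * ln (2 * q i / (p i + q i))).

Definition divM1 p q : R :=
  \sum_(i < n)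
    (Num.sqrt ((p i + q i) / 2) * ((Num.sqrt (p i) + Num.sqrt (q i)) / 2)
     - ((Num.sqrt (p i) + Num.sqrt (q i)) / 2) ^+ 2).

Definition divM2 p q : R :=
  \sum_(i < n)
    ((Num.sqrt (p i) + Num.sqrt (q i)) / 2 * Num.sqrt ((p i + q i) / 2)
     - Num.sqrt (p i * q i)).

Definition divh p q : R :=
  2^-1 * \sum_(i < n) (Num.sqrt (p i) - Num.sqrt (q i)) ^+ 2.

Definition divM3 p q : R :=
  \sum_(i < n)
    ((p i + q i) / 2
     - (Num.sqrt (p i) + Num.sqrt (q i)) / 2 * Num.sqrt ((p i + q i) / 2)).

Definition divJ p q : R := \sum_(i < n) (p i - q i) * ln (p i / q i).

Definition divT p q : R :=
  \sum_(i < n)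
    (p i + q i) / 2 * ln ((p i + q i) / (2 * Num.sqrt (p i * q i))).

Definition divK0 p q : R :=
  \sum_(i < n) (p i - q i) ^+ 2 / Num.sqrt (p i * q i).

Definition divPsi p q : R :=
  \sum_(i < n) (p i - q i) ^+ 2 * (p i + q i) / (p i * q i).

End Divergences.

Inductive div_symbol :=
  | sDelta | sI | sM1 | sM2 | sh | sM3 | sJ | sT | sK0 | sPsi.

(* \bar A; with these constants every \bar A is \sum_i q_i f(p_i / q_i) with
   f(1) = 0, f''(1) = 1/4. *)
Definition normdiv (R : realType) (n : nat) (A : div_symbol)
    (p q : 'I_n -> R) : R :=
  match A with
  | sDelta => 1 / 4 * divDelta p q
  | sI => divI p q
  | sM1 => 4 * divM1 p q
  | sM2 => 4 / 3 * divM2 p q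
  | sh => divh p q
  | sM3 => 4 * divM3 p q
  | sJ => 1 / 8 * divJ p q
  | sT => divT p q
  | sK0 => 1 / 8 * divK0 p q
  | sPsi => 1 / 16 * divPsi p q
  end.

(* [Dnorm A B p q] is D_{AB}(P || Q). *)
Definition Dnorm (R : realType) (n : nat) (A B : div_symbol)
    (p q : 'I_n -> R) : R :=
  normdiv A p q - normdiv B p q.

(* Main.v *)
(* All ten divergences are symmetric sums of terms homogeneous of degree one in
   (p_i, q_i).  Writing p = c (1 + v)^2, q = c (1 - v)^2 with 0 <= v < 1,
   w = v^2, s = sqrt (1 + w) and L(v) = ln ((1 + v) / (1 - v)), each term is c
   times a profile: a rational function of w and s, except J = v L(v),
   T = (1 + w) L(w) and I = 2 J - T.  Every claimed inequality is then a linear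
   consequence of sixteen comparisons of profiles.  Those without logarithms
   follow from Taylor or Pade bounds for s; J <= T and those with I from
   differentiating (T - J) / (1 + w) and I / (1 + w), whose derivatives contain
   only the logarithm L(v); the others from truncations of the power series
   of L. *)

Require Import Defs.
From mathcomp Require Import all_boot all_order all_algebra.
From mathcomp Require Import all_classical all_reals all_analysis.
From mathcomp Require Import ring lra.
Set Implicit Arguments.
Unset Strict Implicit.
Unset Printing Implicit Defensive.
Import Order.TTheory GRing.Theory Num.Theory.
Import numFieldNormedType.Exports.
Local Open Scope ring_scope.
(* [is_derive] is a type class; the alias keeps instance resolution from
   interfering with the syntactic rules below. *)
Definition has_derive (R : realType) (f : R -> R) (x a : R) : Prop :=
  is_derive x 1 f a.

(** * Differentiation rules, and signs of functions from their derivatives *)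

Section Calculus.
Variable R : realType.
Implicit Types (f g df : R -> R) (x t a b c : R).

(** By the mean value theorem [f x] is [df c * x] for some [c] between [0] and [x]. Every
    logarithmic bound below comes from this. *)
Lemma ge0_of_derive f df x : 0 <= x -> f 0 = 0 ->
  (forall t, 0 <= t -> t <= x -> has_derive f t (df t)) ->
  (forall t, 0 <= t -> t <= x -> 0 <= df t) -> 0 <= f x.
Proof.
move=> x0 f0 fdf df0.
have [t||c] := @MVT_segment R f df 0 x x0.
- by rewrite in_itv/= => /andP[t0 tx]; apply: fdf; exact: ltW.
- apply: derivable_within_continuous => t; rewrite in_itv/= => /andP[t0 tx].
  by case: (fdf t t0 tx).
- rewrite in_itv/= f0 !subr0 => /andP[c0 cx] ->.
  by rewrite mulr_ge0// df0.
Qed.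

Lemma has_derive_eq f x a b : has_derive f x a -> a = b -> has_derive f x b.
Proof. by move=> h <-. Qed.

Lemma has_derive_cst c x : has_derive (fun=> c) x 0.
Proof. exact: is_derive_cst. Qed.

Lemma has_derive_id x : has_derive id x 1.
Proof. exact: is_derive_id. Qed.

Lemma has_deriveD f g x a b : has_derive f x a -> has_derive g x b ->
  has_derive (fun t => f t + g t) x (a + b).
Proof. exact: is_deriveD. Qed.

Lemma has_deriveN f x a : has_derive f x a ->
  has_derive (fun t => - f t) x (- a).
Proof. exact: is_deriveN. Qed.

Lemma has_deriveM f g x a b : has_derive f x a -> has_derive g x b ->
  has_derive (fun t => f t * g t) x (f x * b + g x * a).
Proof. exact: is_deriveM. Qed.

Lemma has_deriveX f n x a : has_derive f x a ->
  has_derive (fun t => f t ^+ n) x (n%:R * f x ^+ n.-1 * a).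
Proof. by move=> h; rewrite -exprfctE; exact: is_deriveX. Qed.

Lemma has_deriveV f x a : f x != 0 -> has_derive f x a ->
  has_derive (fun t => (f t)^-1) x (- (f x) ^- 2 * a).
Proof.
move=> fx0 [df <-]; apply: DeriveDef; first exact: derivableV.
by rewrite deriveV.
Qed.

Lemma has_derive_ln f x a : 0 < f x -> has_derive f x a ->
  has_derive (fun t => ln (f t)) x ((f x)^-1 * a).
Proof.
by move=> fx0 h; exact: (is_derive1_comp (is_derive1_ln fx0) h).
Qed.

(** On [(-1, 1)] this is [2 * artanh v]. *)
Definition lnratio v : R := ln (1 + v) - ln (1 - v).

Lemma has_derive_lnratio f x a : -1 < f x -> f x < 1 -> has_derive f x a ->
  has_derive (fun t => lnratio (f t)) x (2 / (1 - f x ^+ 2) * a).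
Proof.
move=> fx0 fx1 h; apply: has_derive_eq.
  apply: has_deriveD; [|apply: has_deriveN]; apply: has_derive_ln => /=;
    try lra.
    apply: has_deriveD; [exact: has_derive_cst | exact: h].
  apply: has_deriveD; [exact: has_derive_cst | apply: has_deriveN; exact: h].
by rewrite /=; field; apply/and3P; split; nra.
Qed.

(* With [p = c (1 + v) ^ 2] and [q = c (1 - v) ^ 2] this is the term of the
   divergence [I] divided by [(p + q) / 2]. *)
Definition relent v : R := 2 * v * lnratio v / (1 + v ^+ 2) - lnratio (v ^+ 2).

(** The rational part [4 t / (1 - t ^+ 4)] of the derivative of the first summand cancels against
    the derivative of [lnratio (t ^+ 2)], so [lnratio t] is the only logarithm left. *)
Lemma has_derive_relent f x a : 0 <= f x -> f x < 1 -> has_derive f x a ->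
  has_derive (fun t => relent (f t)) x
    (2 * (1 - f x ^+ 2) * lnratio (f x) / (1 + f x ^+ 2) ^+ 2 * a).
Proof.
move=> t0 t1 h; rewrite /relent; set t := f x in t0 t1 *.
have w1 : 0 < 1 - t ^+ 2 by nra.
have w0 : 0 <= t ^+ 2 by nra.
apply: has_derive_eq.
  apply: has_deriveD; last first.
    by apply/has_deriveN/has_derive_lnratio/has_deriveX/h; rewrite -/t; lra.
  apply: has_deriveM; last first.
    apply: has_deriveV; first by rewrite lt0r_neq0//= -/t; lra.
    exact/has_deriveD/has_deriveX/h/has_derive_cst.
  apply: has_deriveM; first exact/has_deriveM/h/has_derive_cst.
  by apply: has_derive_lnratio h; rewrite -/t; lra.
rewrite /= -/t; field.
by apply/and3P; split; rewrite lt0r_neq0//; nra.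
Qed.

End Calculus.

(* The arms for eta-reduced functions come first: the patterns [fun t => _]
   match these functions too, but then the rules fail to apply. *)
Ltac has_derive_rules :=
  apply: has_derive_eq;
  [ repeat lazymatch goal with
    | |- has_derive (@lnratio _) _ _ => apply: (has_derive_lnratio (f := id))
    | |- has_derive (@relent _) _ _ => apply: (has_derive_relent (f := id))
    | |- has_derive ( *%R _) _ _ =>
        apply: (has_deriveM (f := fun=> _) (g := id))
    | |- has_derive ( +%R _) _ _ =>
        apply: (has_deriveD (f := fun=> _) (g := id))
    | |- has_derive -%R _ _ => apply: (has_deriveN (f := id))
    | |- has_derive (fun=> ?c) _ _ => exact: has_derive_cst
    | |- has_derive id _ _ => exact: has_derive_id
    | |- has_derive (fun t => t) _ _ => exact: has_derive_id
    | |- has_derive (fun t => _ + _) _ _ => apply: has_deriveD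
    | |- has_derive (fun t => - _) _ _ => apply: has_deriveN
    | |- has_derive (fun t => _ * _) _ _ => apply: has_deriveM
    | |- has_derive (fun t => _ ^+ _) _ _ => apply: has_deriveX
    | |- has_derive (fun t => _ ^-1) _ _ => apply: has_deriveV
    | |- has_derive (fun t => relent _) _ _ => apply: has_derive_relent
    | |- has_derive (fun t => lnratio _) _ _ => apply: has_derive_lnratio
    end
  | rewrite /= ].

(** The arm for differences precedes that for sums because [a - b] is [a + - b]. *)
Ltac nonneg :=
  repeat lazymatch goal with
  | |- is_true (0 <= _ / _) => apply: divr_ge0
  | |- is_true (0 <= _ * _) => apply: mulr_ge0
  | |- is_true (0 <= _ - _) => lra
  | |- is_true (0 <= _ + _) => apply: addr_ge0
  | |- is_true (0 <= _ ^+ _) => apply: exprn_ge0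
  end; lra.

(** * Bounds for [lnratio] and [relent] on [[0, 1)] *)

Section Log.
Variable R : realType.
Implicit Types (v w t : R).

Local Notation L := (@lnratio R).
Local Notation relent := (@relent R).

Lemma lnratio0 : L 0 = 0.
Proof. by rewrite /lnratio subr0 addr0 subrr. Qed.

(** The left-hand side keeps two terms of the series [2 (v + v^3/3 + v^5/5 + ...)]; the derivative
    of the tail is [2 t^4 / (1 - t^2)]. *)
Lemma lnratio_ge v : 0 <= v -> v < 1 -> 2 * v * (1 + v ^+ 2 / 3) <= L v.
Proof.
move=> v0 v1; rewrite -subr_ge0.
apply: (@ge0_of_derive R (fun t => L t - 2 * t * (1 + t ^+ 2 / 3))
  (fun t => 2 * t ^+ 4 / (1 - t ^+ 2))).
- exact: v0.
- by rewrite lnratio0 mulr0 mul0r subrr.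
- move=> t t0 tv; have t1 := le_lt_trans tv v1.
  have w1 : 0 < 1 - t ^+ 2 by nra.
  by has_derive_rules; [lra | lra | field; rewrite lt0r_neq0].
- move=> t t0 tv; apply: divr_ge0; last by nra.
  by apply: mulr_ge0; [lra | rewrite exprn_ge0].
Qed.

(* The right-hand side is [2 v (1 + w / 3 + w ^ 2 / (5 (1 - w)))], [w = v ^ 2]:
   the power series of the logarithm with its tail made geometric. *)
Lemma lnratio_le v : 0 <= v -> v < 1 ->
  L v <= 2 * v * (15 - 10 * v ^+ 2 - 2 * v ^+ 4) / (15 * (1 - v ^+ 2)).
Proof.
move=> v0 v1; rewrite -subr_ge0.
apply: (@ge0_of_derive R (fun t =>
   2 * t * (15 - 10 * t ^+ 2 - 2 * t ^+ 4) / (15 * (1 - t ^+ 2)) - L t)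
  (fun t => 4 / 5 * t ^+ 6 / (1 - t ^+ 2) ^+ 2)).
- exact: v0.
- by rewrite lnratio0 mulr0 !mul0r subrr.
- move=> t t0 tv; have t1 := le_lt_trans tv v1.
  have w1 : 0 < 1 - t ^+ 2 by nra.
  by has_derive_rules; [rewrite mulf_neq0// lt0r_neq0 | lra | lra
                       | field; rewrite lt0r_neq0].
- move=> t t0 tv; apply: divr_ge0; last by rewrite exprn_ge0//; nra.
  by apply: mulr_ge0; [lra | rewrite exprn_ge0].
Qed.

Lemma relent0 : relent 0 = 0.
Proof. by rewrite /relent expr0n /= lnratio0 mulr0 mul0r subrr. Qed.

(** This is [Delta <= I] divided by [1 + v ^+ 2]. The derivative of the difference is a nonnegative
    factor times [L t - 2 t / (1 + t^2)], whose sign follows from [lnratio_ge]. *)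
Lemma relent_ge_Delta v : 0 <= v -> v < 1 ->
  2 * v ^+ 2 / (1 + v ^+ 2) ^+ 2 <= relent v.
Proof.
move=> v0 v1; rewrite -subr_ge0.
apply: (@ge0_of_derive R
  (fun t => relent t - 2 * t ^+ 2 / (1 + t ^+ 2) ^+ 2)
  (fun t => 2 * (1 - t ^+ 2) / (1 + t ^+ 2) ^+ 2
            * (L t - 2 * t / (1 + t ^+ 2)))).
- exact: v0.
- by rewrite relent0 expr0n /= mulr0 mul0r subrr.
- move=> t t0 tv; have t1 := le_lt_trans tv v1.
  have w0 : 0 < 1 + t ^+ 2 by nra.
  by has_derive_rules; [lra | lra | rewrite expf_neq0// lt0r_neq0
                       | field; rewrite lt0r_neq0].
- move=> t t0 tv; have t1 := le_lt_trans tv v1.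
  have w0 : 0 <= t ^+ 2 by nra.
  apply: mulr_ge0; first by rewrite divr_ge0 ?exprn_ge0//; nra.
  rewrite subr_ge0; apply: le_trans (lnratio_ge t0 t1).
  rewrite ler_pdivrMr; last by lra.
  by rewrite -subr_ge0 (_ : _ - _ = 2 * t * (4 / 3 * t ^+ 2 + t ^+ 4 / 3));
    [nonneg | field].
Qed.

(* The bound is [4 (r - 1) / (1 + w)] for the Pade approximant
   [r = (4 + 3 w) / (4 + w)] of [sqrt (1 + w)], [w = v ^ 2]. *)
Lemma relent_le_pade v : 0 <= v -> v < 1 ->
  relent v <= 8 * v ^+ 2 / ((4 + v ^+ 2) * (1 + v ^+ 2)).
Proof.
move=> v0 v1; rewrite -subr_ge0.
apply: (@ge0_of_derive R
  (fun t => 8 * t ^+ 2 / ((4 + t ^+ 2) * (1 + t ^+ 2)) - relent t)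
  (fun t => 2 * (1 - t ^+ 2) / (1 + t ^+ 2) ^+ 2
     * (8 * t * (4 - t ^+ 4) / ((4 + t ^+ 2) ^+ 2 * (1 - t ^+ 2)) - L t))).
- exact: v0.
- by rewrite relent0 expr0n /= mulr0 mul0r subrr.
- move=> t t0 tv; have t1 := le_lt_trans tv v1.
  have w0 : 0 <= t ^+ 2 by nra.
  have w1 : 0 < 1 - t ^+ 2 by nra.
  by has_derive_rules;
    [rewrite mulf_neq0// lt0r_neq0//; lra | lra | lra
    | field; rewrite !lt0r_neq0//; lra].
- move=> t t0 tv; have t1 := le_lt_trans tv v1.
  have w0 : 0 <= t ^+ 2 by nra.
  have w1 : 0 < 1 - t ^+ 2 by nra.
  apply: mulr_ge0; first by rewrite divr_ge0 ?exprn_ge0//; nra.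
  rewrite subr_ge0; apply: le_trans (lnratio_le t0 t1) _.
  rewrite -subr_ge0 (_ : _ - _ =
    2 * t ^+ 3 * (40 + 37 * t ^+ 2 + 26 * t ^+ 4 + 2 * t ^+ 6)
    / (15 * ((4 + t ^+ 2) ^+ 2 * (1 - t ^+ 2)))).
    by nonneg.
  by field; rewrite !lt0r_neq0//; lra.
Qed.

(** This is [6 I <= 5 Delta + Psi] divided by [1 + v ^+ 2], which reduces in the same way to the
    upper bound [lnratio_le]. *)
Lemma relent_le_Delta_Psi v : 0 <= v -> v < 1 ->
  6 * relent v <= 2 * v ^+ 2 / (1 - v ^+ 2) ^+ 2
                  + 10 * v ^+ 2 / (1 + v ^+ 2) ^+ 2.
Proof.
move=> v0 v1; rewrite -subr_ge0.
apply: (@ge0_of_derive R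
  (fun t => 2 * t ^+ 2 / (1 - t ^+ 2) ^+ 2 + 10 * t ^+ 2 / (1 + t ^+ 2) ^+ 2
            - 6 * relent t)
  (fun t => 12 * (1 - t ^+ 2) / (1 + t ^+ 2) ^+ 2
     * (t * (1 + t ^+ 2) ^+ 3 / (3 * (1 - t ^+ 2) ^+ 4)
        + 5 * t / (3 * (1 + t ^+ 2)) - L t))).
- exact: v0.
- by rewrite relent0 expr0n /= !mulr0 !mul0r addr0 subrr.
- move=> t t0 tv; have t1 := le_lt_trans tv v1.
  have w0 : 0 < 1 + t ^+ 2 by nra.
  have w1 : 0 < 1 - t ^+ 2 by nra.
  by has_derive_rules;
    [rewrite expf_neq0// lt0r_neq0 | rewrite expf_neq0// lt0r_neq0
    | lra | lra | field; rewrite !lt0r_neq0].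
- move=> t t0 tv; have t1 := le_lt_trans tv v1.
  have w0 : 0 <= t ^+ 2 by nra.
  have w1 : 0 < 1 - t ^+ 2 by nra.
  apply: mulr_ge0; first by nonneg.
  rewrite subr_ge0; apply: le_trans (lnratio_le t0 t1) _.
  rewrite -subr_ge0 (_ : _ - _ =
    t * (t ^+ 2) ^+ 2 * (144 - 148 * t ^+ 2 + 100 * (t ^+ 2) ^+ 2
      - 12 * (t ^+ 2) ^+ 3 - 4 * (t ^+ 2) ^+ 4)
    / (15 * ((1 - t ^+ 2) ^+ 4 * (1 + t ^+ 2)))).
    move: (t ^+ 2) w0 w1 => w w0 w1.
    apply: divr_ge0; last by nonneg.
    apply: mulr_ge0; first by nonneg.
    (* Bounding the two highest powers by 1 leaves [128 - 148 w + 100 w^2], whose discriminant is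
       negative. *)
    have w3 : w ^+ 3 <= 1 by rewrite exprn_ile1//; lra.
    have w4 : w ^+ 4 <= 1 by rewrite exprn_ile1//; lra.
    by nra.
  by field; rewrite !lt0r_neq0//; lra.
Qed.

(* The numerator is [160 (r - 1)] for the Taylor approximant
   [r = 1 + w / 2 - w ^ 2 / 8 + w ^ 3 / 16] of [sqrt (1 + w)], [w = v ^ 2]. *)
Lemma relent_ge_Psi v : 0 <= v -> v < 1 ->
  (80 * v ^+ 2 - 20 * v ^+ 4 + 10 * v ^+ 6) / (1 + v ^+ 2)
  <= 39 * relent v + 2 * v ^+ 2 / (1 - v ^+ 2) ^+ 2.
Proof.
move=> v0 v1; rewrite -subr_ge0.
apply: (@ge0_of_derive R
  (fun t => 39 * relent t + 2 * t ^+ 2 / (1 - t ^+ 2) ^+ 2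
            - (80 * t ^+ 2 - 20 * t ^+ 4 + 10 * t ^+ 6) / (1 + t ^+ 2))
  (fun t => 78 * (1 - t ^+ 2) / (1 + t ^+ 2) ^+ 2
     * (L t - 2 * t * (40 - 20 * t ^+ 2 + 5 * t ^+ 4 + 10 * t ^+ 6)
                / (39 * (1 - t ^+ 2))
        + 2 * t * (1 + t ^+ 2) ^+ 3 / (39 * (1 - t ^+ 2) ^+ 4)))).
- exact: v0.
- by rewrite relent0 !expr0n /= !mulr0 !mul0r !addr0 subr0 mul0r subr0.
- move=> t t0 tv; have t1 := le_lt_trans tv v1.
  have w0 : 0 < 1 + t ^+ 2 by nra.
  have w1 : 0 < 1 - t ^+ 2 by nra.
  by has_derive_rules;
    [lra | lra | rewrite expf_neq0// lt0r_neq0 | rewrite lt0r_neq0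
    | field; rewrite !lt0r_neq0].
- move=> t t0 tv; have t1 := le_lt_trans tv v1.
  have w0 : 0 <= t ^+ 2 by nra.
  have w1 : 0 < 1 - t ^+ 2 by nra.
  apply: mulr_ge0; first by nonneg.
  have := lnratio_ge t0 t1; rewrite -subr_ge0 => lb.
  (* Splitting off the two-term bound for [L t] leaves a rational function; its cubic factor in
     [t ^+ 2] decreases from 28 to 8 on [[0, 1]]. *)
  rewrite (_ : _ + _ = (L t - 2 * t * (1 + t ^+ 2 / 3))
    + 2 * t * (t ^+ 2) ^+ 3 *
      (28 - 18 * t ^+ 2 - 12 * (t ^+ 2) ^+ 2 + 10 * (t ^+ 2) ^+ 3)
      / (39 * (1 - t ^+ 2) ^+ 4)).
    apply: addr_ge0 => //; move: (t ^+ 2) w0 w1 {lb} => w w0 w1.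
    apply: divr_ge0; last by nonneg.
    apply: mulr_ge0; first by nonneg.
    by nra.
  by field; rewrite !lt0r_neq0//; lra.
Qed.

(** Dividing [J <= T] by [1 + v ^+ 2] frees [L (v ^+ 2)] of its factor, so that its derivative is
    rational and only [L v] remains to be bounded. *)
Lemma lnratio_sqr_ge v : 0 <= v -> v < 1 ->
  v * L v / (1 + v ^+ 2) <= L (v ^+ 2).
Proof.
move=> v0 v1; rewrite -subr_ge0.
apply: (@ge0_of_derive R
  (fun t => L (t ^+ 2) - t * L t / (1 + t ^+ 2))
  (fun t => (1 - t ^+ 2) / (1 + t ^+ 2) ^+ 2
     * (2 * t * (1 + t ^+ 2) / (1 - t ^+ 2) ^+ 2 - L t))).
- exact: v0.
- by rewrite expr0n /= lnratio0 !mul0r subrr.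
- move=> t t0 tv; have t1 := le_lt_trans tv v1.
  have w0 : 0 < 1 + t ^+ 2 by nra.
  have w1 : 0 < 1 - t ^+ 2 by nra.
  by has_derive_rules;
    [lra | lra | lra | lra | rewrite lt0r_neq0
    | field; rewrite !lt0r_neq0//; nra].
- move=> t t0 tv; have t1 := le_lt_trans tv v1.
  have w0 : 0 <= t ^+ 2 by nra.
  have w1 : 0 < 1 - t ^+ 2 by nra.
  apply: mulr_ge0; first by nonneg.
  rewrite subr_ge0; apply: le_trans (lnratio_le t0 t1) _.
  rewrite -subr_ge0 (_ : _ - _ =
    2 * t * t ^+ 2 * (40 - 8 * t ^+ 2 - 2 * (t ^+ 2) ^+ 2)
    / (15 * (1 - t ^+ 2) ^+ 2)).
    move: (t ^+ 2) w0 w1 => w w0 w1.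
    apply: divr_ge0; last by nonneg.
    by apply: mulr_ge0; [nonneg | nra].
  by field; rewrite !lt0r_neq0//; lra.
Qed.

End Log.

(** * Reduction of the divergences to one-variable profiles *)

Section Profile.
Variable R : realType.
Implicit Types (c v w x y : R).

Local Notation L := (@lnratio R).

Definition divterm (A : div_symbol) x y : R :=
  match A with
  | sDelta => 1 / 4 * ((x - y) ^+ 2 / (x + y))
  | sI => (x * ln (2 * x / (x + y)) + y * ln (2 * y / (x + y))) / 2
  | sM1 => 4 * (Num.sqrt ((x + y) / 2) * ((Num.sqrt x + Num.sqrt y) / 2)
                - ((Num.sqrt x + Num.sqrt y) / 2) ^+ 2)
  | sM2 => 4 / 3 * ((Num.sqrt x + Num.sqrt y) / 2 * Num.sqrt ((x + y) / 2)
                    - Num.sqrt (x * y))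
  | sh => (Num.sqrt x - Num.sqrt y) ^+ 2 / 2
  | sM3 => 4 * ((x + y) / 2
                - (Num.sqrt x + Num.sqrt y) / 2 * Num.sqrt ((x + y) / 2))
  | sJ => 1 / 8 * ((x - y) * ln (x / y))
  | sT => (x + y) / 2 * ln ((x + y) / (2 * Num.sqrt (x * y)))
  | sK0 => 1 / 8 * ((x - y) ^+ 2 / Num.sqrt (x * y))
  | sPsi => 1 / 16 * ((x - y) ^+ 2 * (x + y) / (x * y))
  end.

Lemma normdivE n A (p q : 'I_n -> R) :
  normdiv A p q = \sum_(i < n) divterm A (p i) (q i).
Proof.
case: A; rewrite /= -?mulr_sumr -?mulr_suml //.
- by rewrite big_split mulrC.
- by rewrite mulrC.
Qed.

(** Symmetry allows assuming [y <= x], which gives [0 <= v] in the parametrization. *)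
Lemma divtermC A x y : 0 < x -> 0 < y -> divterm A x y = divterm A y x.
Proof.
move=> x0 y0; case: A => /=; rewrite ?[y + x]addrC ?[y * x]mulrC
  ?[Num.sqrt y + _]addrC //.
- by rewrite -sqrrN opprB.
- by congr (_ / _); exact: addrC.
- by rewrite -sqrrN opprB addrC.
- by rewrite -(opprB x y) -(invf_div x y) lnV ?posrE ?divr_gt0// mulrNN.
- by rewrite -sqrrN opprB.
- by rewrite -sqrrN opprB.
Qed.

Definition profile (A : div_symbol) v : R :=
  let w := v ^+ 2 in
  let s := Num.sqrt (1 + w) in
  match A with
  | sDelta => 2 * w / (1 + w)
  | sI => (1 + w) * relent v
  | sM1 => 4 * (s - 1)
  | sM2 => 4 / 3 * (s - 1 + w)
  | sh => 2 * w
  | sM3 => 4 * (1 + w - s)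
  | sJ => v * L v
  | sT => (1 + w) * L w
  | sK0 => 2 * w / (1 - w)
  | sPsi => 2 * w * (1 + w) / (1 - w) ^+ 2
  end.

(** The roots of both arguments become linear in [v], their geometric mean is [c (1 - w)] and their
    arithmetic mean [c (1 + w)], with [w = v^2]; beyond [sqrt c], only [sqrt (1 + w)] survives as a
    root. *)
Lemma divterm_profile A c v : 0 < c -> 0 <= v -> v < 1 ->
  divterm A (c * (1 + v) ^+ 2) (c * (1 - v) ^+ 2) = c * profile A v.
Proof.
move=> c0 v0 v1.
have a0 : 0 < 1 + v by lra.
have b0 : 0 < 1 - v by lra.
have w0 : 0 <= v ^+ 2 by nra.
have w1 : 0 < 1 - v ^+ 2 by nra.
have w2 : 0 < 1 + v ^+ 2 by nra.
have sx : Num.sqrt (c * (1 + v) ^+ 2) = Num.sqrt c * (1 + v).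
  by rewrite sqrtrM ?ltW// sqrtr_sqr ger0_norm// ltW.
have sy : Num.sqrt (c * (1 - v) ^+ 2) = Num.sqrt c * (1 - v).
  by rewrite sqrtrM ?ltW// sqrtr_sqr ger0_norm// ltW.
have sG : Num.sqrt (c * (1 + v) ^+ 2 * (c * (1 - v) ^+ 2)) = c * (1 - v ^+ 2).
  rewrite (_ : _ * _ = (c * (1 - v ^+ 2)) ^+ 2); last by ring.
  by rewrite sqrtr_sqr ger0_norm// mulr_ge0// ltW.
have eD : c * (1 + v) ^+ 2 + c * (1 - v) ^+ 2 = 2 * (c * (1 + v ^+ 2)) by ring.
have sS : Num.sqrt ((c * (1 + v) ^+ 2 + c * (1 - v) ^+ 2) / 2)
          = Num.sqrt c * Num.sqrt (1 + v ^+ 2).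
  by rewrite eD mulrC mulKf// sqrtrM// ltW.
have cc : Num.sqrt c ^+ 2 = c by rewrite sqr_sqrtr// ltW.
have lnw : ln (1 - v ^+ 2) = ln (1 + v) + ln (1 - v).
  by rewrite -lnM ?posrE//; congr ln; ring.
have lnx (k d : R) : 0 < k -> 0 < d -> ln (k ^+ 2 / d) = 2 * ln k - ln d.
  by move=> k0 d0; rewrite ln_div ?posrE ?exprn_gt0// lnXn// mulr_natl.
case: A; rewrite /profile /divterm ?sS ?sx ?sy ?sG.
- by rewrite eD; field; rewrite !lt0r_neq0.
- rewrite eD (_ : 2 * (c * (1 + v) ^+ 2) / (2 * (c * (1 + v ^+ 2)))
              = (1 + v) ^+ 2 / (1 + v ^+ 2)); last first.
    by field; rewrite !lt0r_neq0.
  rewrite (_ : 2 * (c * (1 - v) ^+ 2) / (2 * (c * (1 + v ^+ 2)))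
              = (1 - v) ^+ 2 / (1 + v ^+ 2)); last first.
    by field; rewrite !lt0r_neq0.
  rewrite !lnx// /relent /lnratio lnw.
  field.
  by rewrite lt0r_neq0.
(* Writing [c] as [r ^+ 2] makes the identity polynomial in [r], [v] and [sqrt (1 + v^2)]. *)
- by move: (Num.sqrt c) cc => r <-; field.
- by move: (Num.sqrt c) cc => r <-; field.
- by move: (Num.sqrt c) cc => r <-; field.
- by rewrite eD; move: (Num.sqrt c) cc => r <-; field.
- rewrite (_ : c * (1 + v) ^+ 2 / (c * (1 - v) ^+ 2)
              = (1 + v) ^+ 2 / (1 - v) ^+ 2); last first.
    by field; rewrite !lt0r_neq0.
  by rewrite lnx ?exprn_gt0// lnXn// -mulr_natl /lnratio; field.
- rewrite eD (_ : 2 * (c * (1 + v ^+ 2)) / (2 * (c * (1 - v ^+ 2)))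
              = (1 + v ^+ 2) / (1 - v ^+ 2)); last first.
    by field; rewrite !lt0r_neq0.
  by rewrite ln_div ?posrE// /lnratio; field.
- by field; rewrite !lt0r_neq0.
- by rewrite eD; field; rewrite !lt0r_neq0.
Qed.

(* [v = (sqrt x - sqrt y) / (sqrt x + sqrt y)]. *)
Lemma profile_param x y : 0 < y -> y <= x -> exists c v,
  [/\ 0 < c, 0 <= v, v < 1, x = c * (1 + v) ^+ 2 & y = c * (1 - v) ^+ 2].
Proof.
move=> y0 yx; have x0 : 0 < x := lt_le_trans y0 yx.
have: Num.sqrt y <= Num.sqrt x by exact: ler_wsqrtr.
have: 0 < Num.sqrt x by rewrite sqrtr_gt0.
have: 0 < Num.sqrt y by rewrite sqrtr_gt0.
have: Num.sqrt x ^+ 2 = x by rewrite sqr_sqrtr// ltW.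
have: Num.sqrt y ^+ 2 = y by rewrite sqr_sqrtr// ltW.
move: (Num.sqrt x) (Num.sqrt y) => a b <- <- b0 a0 ba.
have ab0 : 0 < a + b by lra.
exists (((a + b) / 2) ^+ 2), ((a - b) / (a + b)); split.
- by apply: exprn_gt0; lra.
- by apply: divr_ge0; lra.
- by rewrite ltr_pdivrMr//; lra.
- by field; rewrite lt0r_neq0.
- by field; rewrite lt0r_neq0.
Qed.

(** Termwise comparison followed by summation. Each comparison used involves two symbols and
    possibly [sPsi]; [m = 0] covers those without it. *)
Lemma normdiv_le n A B (k l m : R) (p q : 'I_n -> R) :
  (forall i, 0 < p i) -> (forall i, 0 < q i) ->
  (forall v, 0 <= v -> v < 1 ->
     k * profile A v <= l * profile B v + m * profile sPsi v) ->
  k * normdiv A p q <= l * normdiv B p q + m * normdiv sPsi p q.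
Proof.
move=> p0 q0 le_prof.
suff le_term x y : 0 < x -> 0 < y ->
    k * divterm A x y <= l * divterm B x y + m * divterm sPsi x y.
  rewrite !normdivE !mulr_sumr -big_split; apply: ler_sum => i _.
  exact: le_term.
wlog yx : x y / y <= x.
  move=> hw x0 y0; have [yx|/ltW xy] := leP y x; first exact: hw.
  by rewrite !(divtermC _ x0 y0); exact: hw.
move=> _ y0; have [c [v [c0 v0 v1 -> ->]]] := profile_param y0 yx.
rewrite !divterm_profile// ![_ * (c * _)]mulrCA -mulrDr.
by rewrite ler_pM2l// le_prof.
Qed.

(** * Taylor and Pade bounds for [sqrt (1 + w)] *)

Lemma sqrt1D_le1 w : 0 <= w -> Num.sqrt (1 + w) <= 1 + w / 2.
Proof.
(* The polynomial side is rewritten as the root of its square, so that only the radicands need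
   comparing. *)
move=> w0; rewrite -[leRHS]gtr0_norm -?sqrtr_sqr; last by lra.
by rewrite ler_wsqrtr//; nra.
Qed.

Lemma sqrt1D_ge2 w : 0 <= w -> w < 1 ->
  1 + w / 2 - w ^+ 2 / 8 <= Num.sqrt (1 + w).
Proof.
move=> w0 w1; rewrite -[leLHS]gtr0_norm -?sqrtr_sqr; last by nra.
by rewrite ler_wsqrtr//; nra.
Qed.

Lemma sqrt1D_le3 w : 0 <= w -> w < 1 ->
  Num.sqrt (1 + w) <= 1 + w / 2 - w ^+ 2 / 8 + w ^+ 3 / 16.
Proof.
move=> w0 w1; rewrite -[leRHS]gtr0_norm -?sqrtr_sqr; last by nra.
rewrite ler_wsqrtr// -subr_ge0 (_ : _ - _ =
  w ^+ 4 * (5 / 64 - w / 64 + w ^+ 2 / 256)); last by field.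
by apply: mulr_ge0; [nonneg | nra].
Qed.

Lemma sqrt1D_ge_pade w : 0 <= w -> (4 + 3 * w) / (4 + w) <= Num.sqrt (1 + w).
Proof.
move=> w0; rewrite -[leLHS]gtr0_norm -?sqrtr_sqr; last by apply: divr_gt0; lra.
rewrite ler_wsqrtr// -subr_ge0 (_ : _ - _ = w ^+ 3 / (4 + w) ^+ 2).
  by nonneg.
by field; rewrite lt0r_neq0//; lra.
Qed.

Lemma sqr_itv01 v : 0 <= v -> v < 1 ->
  [/\ 0 <= v ^+ 2, v ^+ 2 < 1, 1 - v ^+ 2 != 0 & 1 + v ^+ 2 != 0].
Proof.
move=> v0 v1; have w0 : 0 <= v ^+ 2 by nra.
have w1 : v ^+ 2 < 1 by nra.
by split=> //; rewrite lt0r_neq0//; lra.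
Qed.

(** * Profile bounds and the eight comparisons without [Psi] *)

Lemma profile_T_le_K0 v : 0 <= v -> v < 1 ->
  profile sT v <= profile sK0 v.
Proof.
move=> v0 v1; have [w0 w1 w1_neq0 w2_neq0] := sqr_itv01 v0 v1.
rewrite /profile; move: (v ^+ 2) w0 w1 w1_neq0 w2_neq0 => w w0' w1' wn wp.
have w2 : 0 <= 1 + w by lra.
(* The series bound is taken at the point [w = v^2]; its denominator [1 - w^2] absorbs the factor
   [1 + w]. *)
apply: le_trans (ler_wpM2l w2 (lnratio_le w0' w1')) _.
rewrite -subr_ge0 (_ : _ - _ =
  2 * w ^+ 3 * (10 + 2 * w ^+ 2) / (15 * (1 - w))).
  by nonneg.
have wn2 : 1 - w ^+ 2 != 0 by rewrite lt0r_neq0//; nra.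
by field; rewrite wn wn2.
Qed.

Lemma profile_J_le_T v : 0 <= v -> v < 1 ->
  profile sJ v <= profile sT v.
Proof.
move=> v0 v1; have [w0 _ _ _] := sqr_itv01 v0 v1.
have := lnratio_sqr_ge v0 v1; rewrite ler_pdivrMr; last by lra.
by rewrite /profile [leRHS]mulrC.
Qed.

Lemma profile_J_ge v : 0 <= v -> v < 1 ->
  2 * v ^+ 2 * (1 + v ^+ 2 / 3) <= profile sJ v.
Proof.
move=> v0 v1.
have := ler_wpM2l v0 (lnratio_ge v0 v1); rewrite /profile.
by rewrite (_ : _ * (_ * _) = 2 * v ^+ 2 * (1 + v ^+ 2 / 3)) //; field.
Qed.

Lemma profile_J_le v : 0 <= v -> v < 1 ->
  profile sJ v <=
  2 * v ^+ 2 * (15 - 10 * v ^+ 2 - 2 * (v ^+ 2) ^+ 2) / (15 * (1 - v ^+ 2)).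
Proof.
move=> v0 v1; have [_ _ w1_neq0 _] := sqr_itv01 v0 v1.
have := ler_wpM2l v0 (lnratio_le v0 v1); rewrite /profile.
congr (_ <= _); by field.
Qed.

(** First two terms of the series [2 w (1 + 3 w + 5 w^2 + ...)], [w = v^2]. *)
Lemma profile_Psi_ge v : 0 <= v -> v < 1 ->
    2 * v ^+ 2 + 6 * (v ^+ 2) ^+ 2 <= profile sPsi v.
Proof.
move=> v0 v1; have [w0 w1 w1_neq0 _] := sqr_itv01 v0 v1.
rewrite /profile; move: (v ^+ 2) w0 w1 w1_neq0 => w w0' w1' wn.
rewrite -subr_ge0 (_ : _ - _ =
  2 * w ^+ 3 * (2 + 3 * (1 - w)) / (1 - w) ^+ 2); first by nonneg.
by field.
Qed.

(** Second-order bounds separate the two sides: [M3 <= 2 w + w^2 / 2] and [J >= 2 w + 2 w^2 / 3]. *)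
Lemma profile_M3_le_J v : 0 <= v -> v < 1 ->
  profile sM3 v <= profile sJ v.
Proof.
move=> v0 v1; have [w0 w1 _ _] := sqr_itv01 v0 v1.
have := profile_J_ge v0 v1; have := sqrt1D_ge2 w0 w1.
by rewrite /profile; nra.
Qed.

(** This comparison and the next two are each equivalent to [sqrt (1 + w) <= 1 + w / 2]. *)
Lemma profile_h_le_M3 v : 0 <= v -> v < 1 ->
  profile sh v <= profile sM3 v.
Proof.
move=> v0 v1; have [w0 _ _ _] := sqr_itv01 v0 v1.
by have := sqrt1D_le1 w0; rewrite /profile; lra. Qed.

Lemma profile_M2_le_h v : 0 <= v -> v < 1 ->
  profile sM2 v <= profile sh v.
Proof.
move=> v0 v1; have [w0 _ _ _] := sqr_itv01 v0 v1.
by have := sqrt1D_le1 w0; rewrite /profile; lra. Qed.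

Lemma profile_M1_le_M2 v : 0 <= v -> v < 1 ->
  profile sM1 v <= profile sM2 v.
Proof.
move=> v0 v1; have [w0 _ _ _] := sqr_itv01 v0 v1.
by have := sqrt1D_le1 w0; rewrite /profile; lra. Qed.

Lemma profile_I_le_M1 v : 0 <= v -> v < 1 ->
  profile sI v <= profile sM1 v.
Proof.
move=> v0 v1; have [w0 _ _ w2_neq0] := sqr_itv01 v0 v1.
have w2 : 0 <= 1 + v ^+ 2 by lra.
have w4 : 4 + v ^+ 2 != 0 by rewrite lt0r_neq0//; lra.
apply: le_trans (ler_wpM2l w2 (relent_le_pade v0 v1)) _.
rewrite (_ : _ * (_ / _) = 4 * ((4 + 3 * v ^+ 2) / (4 + v ^+ 2) - 1)).
  by have := sqrt1D_ge_pade w0; rewrite /profile; lra.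
by field; rewrite w2_neq0 w4.
Qed.

Lemma profile_Delta_le_I v : 0 <= v -> v < 1 ->
  profile sDelta v <= profile sI v.
Proof.
move=> v0 v1; have [w0 _ _ w2_neq0] := sqr_itv01 v0 v1.
have w2 : 0 <= 1 + v ^+ 2 by lra.
apply: le_trans (ler_wpM2l w2 (relent_ge_Delta v0 v1)).
by rewrite le_eqVlt; apply/orP; left; apply/eqP; rewrite /profile; field.
Qed.

(** * The eight comparisons involving [Psi] *)

(** The weights here and in the next seven lemmas come from clearing denominators in the theorem.
    They make the coefficients of [w] and [w^2] agree on both sides, so any bound inserted must be
    exact to second order. *)
Lemma profile_I_le_Delta_Psi v : 0 <= v -> v < 1 ->
    6 * profile sI v <= 5 * profile sDelta v + 1 * profile sPsi v.
Proof.
move=> v0 v1; have [w0 _ w1_neq0 w2_neq0] := sqr_itv01 v0 v1.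
have w2 : 0 <= 1 + v ^+ 2 by lra.
have := ler_wpM2l w2 (relent_le_Delta_Psi v0 v1); rewrite /profile.
by congr (_ <= _); field; rewrite ?w1_neq0 ?w2_neq0.
Qed.

Lemma profile_M1_le_I_Psi v : 0 <= v -> v < 1 ->
    40 * profile sM1 v <= 39 * profile sI v + 1 * profile sPsi v.
Proof.
move=> v0 v1; have [w0 w1 w1_neq0 w2_neq0] := sqr_itv01 v0 v1.
have w2 : 0 <= 1 + v ^+ 2 by lra.
have := ler_wpM2l w2 (relent_ge_Psi v0 v1).
rewrite mulrC divfK// => h.
(* The middle term is [160 (r - 1)] for the third-order Taylor bound [r], while [40 * profile sM1 v]
   is [160 (s - 1)]. *)
apply: (@le_trans _ _ (80 * v ^+ 2 - 20 * v ^+ 4 + 10 * v ^+ 6)).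
  have := sqrt1D_le3 w0 w1; rewrite -!exprM /profile; lra.
by apply: le_trans h _; rewrite /profile le_eqVlt; apply/orP; left;
  apply/eqP; field.
Qed.

(** In this lemma and the next two, inserting the second-order lower bounds for [s] and [Psi] leaves
    an exact identity. *)
Lemma profile_M2_le_M1_Psi v : 0 <= v -> v < 1 ->
    39 * profile sM2 v <= 37 * profile sM1 v + 2 * profile sPsi v.
Proof.
move=> v0 v1; have [w0 w1 _ _] := sqr_itv01 v0 v1.
have := profile_Psi_ge v0 v1; have := sqrt1D_ge2 w0 w1; rewrite /profile; lra.
Qed.

Lemma profile_h_le_M2_Psi v : 0 <= v -> v < 1 ->
    37 * profile sh v <= 36 * profile sM2 v + 1 * profile sPsi v.
Proof.
move=> v0 v1; have [w0 w1 _ _] := sqr_itv01 v0 v1.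
have := profile_Psi_ge v0 v1; have := sqrt1D_ge2 w0 w1; rewrite /profile; lra.
Qed.

Lemma profile_M3_le_h_Psi v : 0 <= v -> v < 1 ->
    12 * profile sM3 v <= 11 * profile sh v + 1 * profile sPsi v.
Proof.
move=> v0 v1; have [w0 w1 _ _] := sqr_itv01 v0 v1.
have := profile_Psi_ge v0 v1; have := sqrt1D_ge2 w0 w1; rewrite /profile; lra.
Qed.

Lemma profile_J_le_h_Psi v : 0 <= v -> v < 1 ->
    9 * profile sJ v <= 8 * profile sh v + 1 * profile sPsi v.
Proof.
move=> v0 v1; have [w0 w1 w1_neq0 _] := sqr_itv01 v0 v1.
have J9 : 9 * profile sJ v <= 9 * _ :=
  ler_wpM2l (ler0n _ 9) (profile_J_le v0 v1).
apply: le_trans J9 _; rewrite /profile.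
move: (v ^+ 2) w0 w1 w1_neq0 => w w0' w1' wn.
rewrite -subr_ge0 (_ : _ - _ =
  2 * w ^+ 3 * (10 + 6 * (1 - w)) / (5 * (1 - w) ^+ 2)); first by nonneg.
by field.
Qed.

Lemma profile_K0_le_J_Psi v : 0 <= v -> v < 1 ->
    4 * profile sK0 v <= 3 * profile sJ v + 1 * profile sPsi v.
Proof.
move=> v0 v1; have [w0 w1 w1_neq0 _] := sqr_itv01 v0 v1.
have J3 : 3 * _ <= 3 * profile sJ v :=
  ler_wpM2l (ler0n _ 3) (profile_J_ge v0 v1).
rewrite -lerBlDr; apply: le_trans J3; rewrite /profile.
move: (v ^+ 2) w0 w1 w1_neq0 => w w0' w1' wn.
rewrite -subr_ge0 (_ : _ - _ =
  2 * w ^+ 3 * (1 + w) / (1 - w) ^+ 2); first by nonneg.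
by field.
Qed.

Lemma profile_K0_le_M3_Psi v : 0 <= v -> v < 1 ->
    11 * profile sK0 v <= 8 * profile sM3 v + 3 * profile sPsi v.
Proof.
move=> v0 v1; have [w0 w1 w1_neq0 _] := sqr_itv01 v0 v1.
have := sqrt1D_le3 w0 w1; rewrite /profile.
move: (v ^+ 2) w0 w1 w1_neq0 => w w0' w1' wn.
move: (Num.sqrt _) => s sle.
(* [M3] decreases in [s], so the third-order upper bound for [s] is inserted; the difference then
   starts at [w^3]. *)
have : 0 <= 8 * (4 * (w / 2 + w ^+ 2 / 8 - w ^+ 3 / 16))
  + 3 * (2 * w * (1 + w) / (1 - w) ^+ 2) - 11 * (2 * w / (1 - w)).
  rewrite (_ : _ - _ =
    w ^+ 3 * (6 + 6 * w + 2 * w * (1 - w)) / (1 - w) ^+ 2); first by nonneg.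
  by field.
lra.
Qed.

End Profile.

(** * Assembly of the inequalities *)

Unset Implicit Arguments.

Theorem mainTheorem3 (R : realType) (n : nat) (hn : (2 <= n)%N)
    (p q : 'I_n -> R)
    (hp : forall i : 'I_n, 0 < p i) (hq : forall i : 'I_n, 0 < q i)
    (hp1 : \sum_(i < n) p i = 1) (hq1 : \sum_(i < n) q i = 1) :
  (Dnorm sPsi sK0 p q <= Dnorm sPsi sT p q /\
   Dnorm sPsi sT p q <= Dnorm sPsi sJ p q /\
   Dnorm sPsi sJ p q <= Dnorm sPsi sM3 p q /\
   Dnorm sPsi sM3 p q <= Dnorm sPsi sh p q /\
   Dnorm sPsi sh p q <= Dnorm sPsi sM2 p q /\
   Dnorm sPsi sM2 p q <= Dnorm sPsi sM1 p q /\
   Dnorm sPsi sM1 p q <= Dnorm sPsi sI p q /\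
   Dnorm sPsi sI p q <= Dnorm sPsi sDelta p q)
  /\
  (Dnorm sPsi sDelta p q <= 6 / 5 * Dnorm sPsi sI p q /\
   6 / 5 * Dnorm sPsi sI p q <= 16 / 13 * Dnorm sPsi sM1 p q /\
   16 / 13 * Dnorm sPsi sM1 p q <= 48 / 37 * Dnorm sPsi sM2 p q /\
   48 / 37 * Dnorm sPsi sM2 p q <= 4 / 3 * Dnorm sPsi sh p q)
  /\
  (4 / 3 * Dnorm sPsi sh p q <= 3 / 2 * Dnorm sPsi sJ p q /\
   3 / 2 * Dnorm sPsi sJ p q <= 2 * Dnorm sPsi sK0 p q)
  /\
  (4 / 3 * Dnorm sPsi sh p q <= 16 / 11 * Dnorm sPsi sM3 p q /\
   16 / 11 * Dnorm sPsi sM3 p q <= 2 * Dnorm sPsi sK0 p q)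
  /\
  2 * Dnorm sPsi sK0 p q <= 2 * Dnorm sPsi sT p q.
Proof.
have chain A B :
    (forall v : R, 0 <= v -> v < 1 -> profile A v <= profile B v) ->
    normdiv A p q <= normdiv B p q.
  move=> AB; have := @normdiv_le R n A B 1 1 0 p q hp hq.
  by rewrite !mul1r mul0r addr0; apply=> v v0 v1;
    rewrite !mul1r mul0r addr0 AB.
have TK := chain _ _ (@profile_T_le_K0 R).
have JT := chain _ _ (@profile_J_le_T R).
have MJ := chain _ _ (@profile_M3_le_J R).
have hM := chain _ _ (@profile_h_le_M3 R).
have Mh := chain _ _ (@profile_M2_le_h R).
have MM := chain _ _ (@profile_M1_le_M2 R).
have IM := chain _ _ (@profile_I_le_M1 R).
have DI := chain _ _ (@profile_Delta_le_I R).
have IDP := normdiv_le hp hq (@profile_I_le_Delta_Psi R).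
have MIP := normdiv_le hp hq (@profile_M1_le_I_Psi R).
have MMP := normdiv_le hp hq (@profile_M2_le_M1_Psi R).
have hMP := normdiv_le hp hq (@profile_h_le_M2_Psi R).
have MhP := normdiv_le hp hq (@profile_M3_le_h_Psi R).
have JhP := normdiv_le hp hq (@profile_J_le_h_Psi R).
have KJP := normdiv_le hp hq (@profile_K0_le_J_Psi R).
have KMP := normdiv_le hp hq (@profile_K0_le_M3_Psi R).
move: {chain} TK JT MJ hM Mh MM IM DI IDP MIP MMP hMP MhP JhP KJP KMP.
rewrite /Dnorm.
(* With the ten divergences as free reals, each claim is linear in the sixteen comparisons; for
   instance [4/3 D_{Psi h} <= 3/2 D_{Psi J}] is [9 J <= 8 h + Psi]. *)
move: (normdiv sDelta p q) (normdiv sI p q) (normdiv sM1 p q)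
  (normdiv sM2 p q) (normdiv sh p q) (normdiv sM3 p q) (normdiv sJ p q)
  (normdiv sT p q) (normdiv sK0 p q) (normdiv sPsi p q)
  => D I M1 M2 h M3 J T K0 Psi.
by do ![split | move=> ?]; lra.
Qed.
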